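(* Let $n\ge1$ and let $u$ be a smooth real-valued function defined in a neighborhood of $0\in\mathbb{H}^n$ with $\nabla_{\mathbb{H}^n}u(0)\neq0$. For small $\epsilon>0$ let $P_{\epsilon,M}=(x_{\epsilon,M},y_{\epsilon,M},t_{\epsilon,M})$ and $P_{\epsilon,m}=(x_{\epsilon,m},y_{\epsilon,m},t_{\epsilon,m})$ be points of $\partial B(0,\epsilon)$ such that $$\max_{\overline{B(0,\epsilon)}}u=u(P_{\epsilon,M})\quad\text{and}\quad\min_{\overline{B(0,\epsilon)}}u=u(P_{\epsilon,m}).$$ Then $$\lim_{\epsilon\to0}\frac{(x_{\epsilon,M},y_{\epsilon,M})}{\epsilon}=\frac{\nabla_{\mathbb{H}^n}u(0)}{|\nabla_{\mathbb{H}^n}u(0)|},\qquad \lim_{\epsilon\to0}\frac{(x_{\epsilon,m},y_{\epsilon,m})}{\epsilon}=-\frac{\nabla_{\mathbb{H}^n}u(0)}{|\nabla_{\mathbb{H}^n}u(0)|}.$$ Moreover, both for $t_\epsilon=t_{\epsilon,M}$ and for $t_\epsilon=t_{\epsilon,m}$, $$\lim_{\epsilon\to0}\frac{|t_\epsilon|}{\epsilon^3}=\frac{2|\partial_tu(0)|}{|\nabla_{\mathbb{H}^n}u(0)|}.$$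
   Context: $\mathbb{H}^n$ is $\mathbb{R}^{2n+1}$, with points $P=(x,y,t)$, $x,y\in\mathbb{R}^n$, $t\in\mathbb{R}$, and group law $(x_1,y_1,t_1)\star(x_2,y_2,t_2)=(x_1+x_2,y_1+y_2,t_1+t_2+2(x_2\cdot y_1-x_1\cdot y_2))$. The gauge is $\|(x,y,t)\|=\big((|x|^2+|y|^2)^2+t^2\big)^{1/4}$, and $B(0,\epsilon)=\{P:\|P\|<\epsilon\}$. With $X_i=\partial_{x_i}+2y_i\partial_t$ and $Y_i=\partial_{y_i}-2x_i\partial_t$, the horizontal gradient is identified with the vector $\nabla_{\mathbb{H}^n}u=(X_1u,\dots,X_nu,Y_1u,\dots,Y_nu)\in\mathbb{R}^{2n}$, with the Euclidean norm. *)

(* Defs.v *)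
From HB Require Import structures.
From mathcomp Require Import all_boot all_order all_algebra.
From mathcomp Require Import all_classical all_reals all_analysis.

Set Implicit Arguments.
Unset Strict Implicit.
Unset Printing Implicit Defensive.

Import Order.TTheory GRing.Theory Num.Theory.
Import numFieldNormedType.Exports.

Local Open Scope classical_set_scope.
Local Open Scope ring_scope.

(* The carrier R^n * R^n * R of H^n, with its usual (product) topology. *)
Notation heis R n := ('rV[R]_n * 'rV[R]_n * R)%type.

Section Heisenberg.
Context {R : realType} {n : nat}.
Implicit Types (P : heis R n) (u : heis R n -> R).

Definition xc P : 'rV[R]_n := P.1.1.
Definition yc P : 'rV[R]_n := P.1.2.
Definition tc P : R := P.2.

Definition horiz P : 'rV[R]_(n + n) := row_mx (xc P) (yc P).

(* The library norm on 'rV is the sup norm, hence this separate definition. *)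
Definition enorm m (v : 'rV[R]_m) : R := Num.sqrt (\sum_(i < m) v 0 i ^+ 2).

Definition gauge P : R :=
  ((enorm (xc P) ^+ 2 + enorm (yc P) ^+ 2) ^+ 2 + tc P ^+ 2) `^ (4^-1).

Definition hball (eps : R) : set (heis R n) := [set P | gauge P < eps].

Inductive coord := CoordX of 'I_n | CoordY of 'I_n | CoordT.

Definition basis (c : coord) : heis R n :=
  match c with
  | CoordX i => (delta_mx 0 i, 0, 0)
  | CoordY i => (0, delta_mx 0 i, 0)
  | CoordT => (0, 0, 1)
  end.

Definition partial (c : coord) u : heis R n -> R := fun P => 'D_(basis c) u P.

Definition iter_partial (s : seq coord) u : heis R n -> R :=
  foldr partial u s.

(* Partial derivatives of all orders exist and are continuous at every point
   of U. For U open this does not depend on the values of u outside U. *)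
Definition smooth_on (U : set (heis R n)) u : Prop :=
  forall (s : seq coord) P, U P ->
    {for P, continuous (iter_partial s u)} /\
    (forall c, derivable (iter_partial s u) P (basis c)).

Definition Xfield (i : 'I_n) u P : R :=
  partial (CoordX i) u P + 2 * yc P 0 i * partial CoordT u P.

Definition Yfield (i : 'I_n) u P : R :=
  partial (CoordY i) u P - 2 * xc P 0 i * partial CoordT u P.

Definition hgrad u P : 'rV[R]_(n + n) :=
  row_mx (\row_i Xfield i u P) (\row_i Yfield i u P).

End Heisenberg.

Definition boundary {T : topologicalType} (A : set T) : set T :=
  closure A `\` interior A.

(* Main.v *)
Require Import Defs.
From HB Require Import structures.
From mathcomp Require Import all_boot all_order all_algebra.
From mathcomp Require Import all_classical all_reals all_analysis.
From mathcomp Require Import ring lra.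

Set Implicit Arguments.
Unset Strict Implicit.
Unset Printing Implicit Defensive.

Import Order.TTheory GRing.Theory Num.Theory.
Import numFieldNormedType.Exports.

Local Open Scope classical_set_scope.
Local Open Scope ring_scope.

(* At a maximum point P of u on the closed gauge ball, the derivative of u is
   nearly nonpositive in every direction that decreases N = (|x|^2+|y|^2)^2+t^2;
   hence, up to an error tending to 0 with epsilon, the Euclidean gradient of u
   at 0 is lam * grad N (P) = lam * (4 r^2 (x, y), 2 t) with lam > 0 and
   r = |(x, y)|.  So 4 lam r^2 (x, y) tends to the horizontal gradient a and
   2 lam t to b = u_t(0), whence (x, y) / r -> a / |a| and t / r^3 -> 2 b / |a|;
   then r / epsilon -> 1 because r^4 + t^2 = epsilon^4.  Minima are maxima of
   - u. *)

(** * Mean value estimates along lines and along chains of directions *)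

Lemma is_derive_line (R : realType) (V : normedModType R) (u : V -> R)
    (x e : V) (a : R) :
  derivable u (x + a *: e) e ->
  is_derive a 1 (fun r : R => u (x + r *: e)) ('D_e u (x + a *: e)).
Proof.
(* The difference quotient of the restriction at [a] and that of [u] at [x + a *: e] along [e] are
   the same function of [h]. *)
have E : (fun h : R => h^-1 *: (((fun r : R => u (x + r *: e)) \o shift a)
            (h *: (1:R)) - u (x + a *: e)))
       = (fun h : R => h^-1 *: ((u \o shift (x + a *: e)) (h *: e)
            - u (x + a *: e))).
  apply/funext => h /=; congr (_ *: (u _ - _)).
  by rewrite -[h *: 1]/(h * 1) mulr1 scalerDl addrCA.
by move=> du; split; rewrite /derivable /derive /= E.
Qed.

Lemma line_increment_le (R : realType) (V : normedModType R) (u : V -> R)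
    (x e : V) (l eta h : R) :
  (forall a : R, `|a| <= `|h| -> derivable u (x + a *: e) e /\
     `|'D_e u (x + a *: e) - l| <= eta) ->
  `|u (x + h *: e) - u x - h * l| <= eta * `|h|.
Proof.
move=> H.
(* Stated for an ordered pair so that both signs of [h] are covered, by the pairs [0, h] and
   [h, 0]. *)
have mvt (a b : R) : a <= b -> `|a| <= `|h| -> `|b| <= `|h| ->
    `|u (x + b *: e) - u (x + a *: e) - (b - a) * l| <= eta * (b - a).
  move=> ab ah bh.
  have inside c : c \in `[a, b] -> `|c| <= `|h|.
    rewrite in_itv /= => /andP[ac cb]; rewrite ler_norml.
    move: ah bh; rewrite !ler_norml => /andP[h1 h2] /andP[h3 h4].
    by rewrite (le_trans h1) ?(le_trans cb).
  have D c : c \in `[a, b] ->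
      is_derive c 1 (fun r : R => u (x + r *: e)) ('D_e u (x + c *: e)).
    by move=> /inside /H[+ _]; exact: is_derive_line.
  have C : {within `[a, b], continuous (fun r : R => u (x + r *: e))}.
    by apply: derivable_within_continuous => c /D [].
  have D' c : c \in `]a, b[ ->
      is_derive c 1 (fun r : R => u (x + r *: e)) ('D_e u (x + c *: e)).
    by move=> /subset_itv_oo_cc; exact: D.
  have [c cab E] := MVT_segment ab D' C.
  rewrite {}E.
  rewrite mulrC -mulrBr normrM mulrC (@ger0_norm _ (b - a)) ?subr_ge0//.
  by rewrite ler_wpM2r ?subr_ge0//; have [] := H _ (inside _ cab).
have [h0|h0] := leP 0 h.
  have := mvt 0 h h0; rewrite normr0 normr_ge0 lexx => /(_ isT isT).
  by rewrite scale0r addr0 subr0 (ger0_norm h0).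
have := mvt h 0 (ltW h0); rewrite normr0 normr_ge0 lexx => /(_ isT isT).
rewrite scale0r addr0 sub0r (ltr0_norm h0) -normrN.
by congr (`| _ | <= _); ring.
Qed.

(* Moving along the directions one after the other keeps the path in the ball,
   so one-variable mean value estimates can be added up. *)
Lemma multi_increment_le (R : realType) (V : normedModType R) (I : Type)
    (e : I -> V) (u : V -> R) (l : I -> R) (delta eta : R) :
  (forall x i, `|x| < delta -> derivable u x (e i) /\
     `|'D_(e i) u x - l i| <= eta) ->
  forall (s : seq I) (h : I -> R) x,
    `|x| + \sum_(i <- s) `|h i| * `|e i| < delta ->
    `|u (x + \sum_(i <- s) h i *: e i) - u x - \sum_(i <- s) h i * l i|
      <= eta * \sum_(i <- s) `|h i|.
Proof.
move=> H; elim=> [|i s IH] h x.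
  by rewrite !big_nil !addr0 !subr0 subrr normr0 mulr0.
rewrite !big_cons => small.
have rest_ge0 : 0 <= \sum_(j <- s) `|h j| * `|e j|.
  by apply: sumr_ge0 => j _; rewrite mulr_ge0.
have xh : `|x + h i *: e i| <= `|x| + `|h i| * `|e i|.
  by rewrite -normrZ ler_normD.
have first : `|u (x + h i *: e i) - u x - h i * l i| <= eta * `|h i|.
  apply: line_increment_le => a ah; apply: H.
  apply: (le_lt_trans (ler_normD _ _)); rewrite normrZ.
  apply: le_lt_trans small; rewrite lerD2l.
  by rewrite ler_wpDr// ler_wpM2r.
have next : `|x + h i *: e i| + \sum_(j <- s) `|h j| * `|e j| < delta.
  by apply: le_lt_trans small; rewrite addrA lerD2r.
have := lerD first (IH h _ next).
rewrite -mulrDr; apply: le_trans; apply: le_trans (ler_normD _ _).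
by rewrite addrA le_eqVlt; apply/orP; left; apply/eqP; congr `| _ |; ring.
Qed.

(** * Coordinates and the Euclidean structure of R^(2n+1) *)

Definition coords n : seq (@Defs.coord n) :=
  [seq CoordX i | i <- index_enum 'I_n] ++ [seq CoordY i | i <- index_enum 'I_n]
  ++ [:: CoordT].

Definition coef (R : realType) n (c : @Defs.coord n) (P : heis R n) : R :=
  match c with
  | CoordX i => xc P 0 i
  | CoordY i => yc P 0 i
  | CoordT => tc P
  end.

Lemma sum_coords (V : nmodType) n (F : @Defs.coord n -> V) :
  \sum_(c <- coords n) F c =
  \sum_i F (CoordX i) + \sum_i F (CoordY i) + F CoordT.
Proof. by rewrite !big_cat !big_map big_seq1 /= addrA. Qed.

Lemma sum_coef_basis (R : realType) n (P : heis R n) :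
  \sum_(c <- coords n) coef c P *: Defs.basis c = P.
Proof.
rewrite sum_coords /=; case: P => [[x y] t]; rewrite /xc /yc /tc /=.
have -> : \sum_i x 0 i *: (delta_mx 0 i, 0, 0) = (x, 0, 0) :> heis R n.
  have D (v w : 'rV[R]_n) : (v + w, 0, 0) = (v, 0, 0) + (w, 0, 0) :> heis R n.
    by congr (_, _, _); rewrite /= addr0.
  rewrite [in RHS](row_sum_delta x).
  rewrite (big_morph (fun v => (v, 0, 0) : heis R n) D erefl).
  by apply: eq_bigr => i _; congr (_, _, _); rewrite /= scaler0.
have -> : \sum_i y 0 i *: (0, delta_mx 0 i, 0) = (0, y, 0) :> heis R n.
  have D (v w : 'rV[R]_n) : (0, v + w, 0) = (0, v, 0) + (0, w, 0) :> heis R n.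
    by congr (_, _, _); rewrite /= addr0.
  rewrite [in RHS](row_sum_delta y).
  rewrite (big_morph (fun v => (0, v, 0) : heis R n) D erefl).
  by apply: eq_bigr => i _; congr (_, _, _); rewrite /= scaler0.
congr (_, _, _) => /=; rewrite ?scaler0 ?addr0 ?add0r//.
exact: mulr1.
Qed.

Lemma coefD (R : realType) n (c : @Defs.coord n) (P Q : heis R n) :
  coef c (P + Q) = coef c P + coef c Q.
Proof. by case: c => [i|i|] //=; rewrite mxE. Qed.

Lemma coefZ (R : realType) n (c : @Defs.coord n) (a : R) (P : heis R n) :
  coef c (a *: P) = a * coef c P.
Proof. by case: c => [i|i|] //=; rewrite mxE. Qed.

Definition dot (R : realType) n (P Q : heis R n) : R :=
  \sum_(c <- coords n) coef c P * coef c Q.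

Lemma dotC (R : realType) n (P Q : heis R n) : dot P Q = dot Q P.
Proof. by apply: eq_bigr => c _; rewrite mulrC. Qed.

Lemma dotDr (R : realType) n (P Q S : heis R n) :
  dot P (Q + S) = dot P Q + dot P S.
Proof. by rewrite -big_split; apply: eq_bigr => c _; rewrite coefD mulrDr. Qed.

Lemma dotZr (R : realType) n (a : R) (P Q : heis R n) :
  dot P (a *: Q) = a * dot P Q.
Proof. by rewrite mulr_sumr; apply: eq_bigr => c _; rewrite coefZ mulrCA. Qed.

Lemma dotDl (R : realType) n (P Q S : heis R n) :
  dot (Q + S) P = dot Q P + dot S P.
Proof. by rewrite dotC dotDr !(dotC P). Qed.

Lemma dotZl (R : realType) n (a : R) (P Q : heis R n) :
  dot (a *: Q) P = a * dot Q P.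
Proof. by rewrite dotC dotZr (dotC P). Qed.

Lemma dot_ge0 (R : realType) n (P : heis R n) : 0 <= dot P P.
Proof. by apply: sumr_ge0 => c _; rewrite -expr2 sqr_ge0. Qed.

Lemma coef_sqr_le_dot (R : realType) n (c : @Defs.coord n) (P : heis R n) :
  coef c P ^+ 2 <= dot P P.
Proof.
have sumsq (v : 'rV[R]_n) i : v 0 i ^+ 2 <= \sum_j v 0 j * v 0 j.
  by rewrite expr2 (bigD1 i)//= lerDl sumr_ge0// => j _; rewrite -expr2 sqr_ge0.
have sumge0 (v : 'rV[R]_n) : 0 <= \sum_j v 0 j * v 0 j.
  by rewrite sumr_ge0// => j _; rewrite -expr2 sqr_ge0.
have := sumge0 (xc P); have := sumge0 (yc P); have := sqr_ge0 (tc P).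
rewrite /dot sum_coords /= -expr2.
case: c => [i|i|] /=; [have := sumsq (xc P) i|have := sumsq (yc P) i|]; lra.
Qed.

(** The Euclidean norm with the vertical coordinate included, not the gauge; [|P|] is the sup norm
    that defines neighbourhoods. *)
Definition hnorm (R : realType) n (P : heis R n) : R := Num.sqrt (dot P P).

Lemma coef_le_hnorm (R : realType) n (c : @Defs.coord n) (P : heis R n) :
  `|coef c P| <= hnorm P.
Proof. by rewrite -sqrtr_sqr ler_wsqrtr// coef_sqr_le_dot. Qed.

Lemma rV_norm_le (R : realType) m (v : 'rV[R]_m) (a : R) : 0 <= a ->
  (forall i, `|v 0 i| <= a) -> `|v| <= a.
Proof.
move=> a0 va; rewrite [`|v|]mx_normrE; apply: bigmax_le => // -[i j] _ /=.
by rewrite ord1.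
Qed.

Lemma norm_le_hnorm (R : realType) n (P : heis R n) : `|P| <= hnorm P.
Proof.
rewrite !prod_normE !ge_max (coef_le_hnorm CoordT P) andbT.
by apply/andP; split; apply: rV_norm_le; rewrite ?sqrtr_ge0// => i;
  [exact: (coef_le_hnorm (CoordX i)) | exact: (coef_le_hnorm (CoordY i))].
Qed.

(** * The Euclidean gradient at 0 and strict differentiability there *)

Definition grad0 (R : realType) n (u : heis R n -> R) : heis R n :=
  (\row_i partial (CoordX i) u 0, \row_i partial (CoordY i) u 0,
   partial CoordT u 0).

Lemma coef_grad0 (R : realType) n (u : heis R n -> R) c :
  coef c (grad0 u) = partial c u 0.
Proof. by case: c => [i|i|] //=; rewrite mxE. Qed.

(** Smoothness is used at order zero for existence of the partials on [U] and at order one for their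
    continuity at 0. There are finitely many directions, so one neighbourhood serves all of them. *)
Lemma near_partial (R : realType) n (U : set (heis R n)) (u : heis R n -> R)
    (eta : R) : open U -> U 0 -> smooth_on U u -> 0 < eta ->
  \forall x \near (0 : heis R n), forall c, derivable u x (Defs.basis c) /\
    `|'D_(Defs.basis c) u x - coef c (grad0 u)| <= eta.
Proof.
move=> openU U0 smooth_u eta0.
pose near_at c (x : heis R n) := derivable u x (Defs.basis c) /\
  `|'D_(Defs.basis c) u x - coef c (grad0 u)| <= eta.
have near1 c : \forall x \near (0 : heis R n), near_at c x.
  near=> x; split.
    have [|_] := smooth_u [::] x; last exact.
    by near: x; exact: open_nbhs_nbhs.
  rewrite coef_grad0; near: x.
  have [cc _] := smooth_u [:: c] 0 U0.
  exact: (cvgr_distC_le _ _ cc).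
have nearX : \forall x \near (0 : heis R n), forall i, near_at (CoordX i) x.
  by apply: (filter_forall (nbhs_filter (0 : heis R n))) => i; exact: near1.
have nearY : \forall x \near (0 : heis R n), forall i, near_at (CoordY i) x.
  by apply: (filter_forall (nbhs_filter (0 : heis R n))) => i; exact: near1.
have nearT := near1 CoordT.
apply: (@filterS3 _ _ (nbhs_filter (0 : heis R n)) _ _ _ _ _
  nearX nearY nearT) => x HX HY HT.
by case=> [i|i|]; [exact: HX | exact: HY | exact: HT].
Unshelve. all: by end_near. Qed.

(** The base point [x] varies near 0 because the expansion is taken at the extremal points, not at
    0. The neighbourhood is chosen before [v], since the test directions depend on the extremal
    point; only the range of [h] may depend on [v]. *)
Definition strict_diff0 (R : realType) n (u : heis R n -> R) (l : heis R n) :=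
  forall eta : R, 0 < eta -> \forall x \near (0 : heis R n),
    forall v : heis R n, \forall h \near 0^'+,
    `|u (x + h *: v) - u x - h * dot l v| <= h * (eta * hnorm v).

Lemma smooth_strict_diff0 (R : realType) n (U : set (heis R n))
    (u : heis R n -> R) :
  open U -> U 0 -> smooth_on U u -> strict_diff0 u (grad0 u).
Proof.
move=> openU U0 smooth_u eta eta0.
(* Each coordinate direction costs at most [eta / K] times [hnorm v], so the total stays below
   [eta * hnorm v]. *)
pose K : R := (size (coords n)).+1%:R.
have K0 : 0 < K by rewrite ltr0n.
have eta'0 : 0 < eta / K by rewrite divr_gt0.
have /nbhs_normP[delta /= delta0 Hd] := near_partial openU U0 smooth_u eta'0.
have {Hd} H x c : `|x| < delta -> derivable u x (Defs.basis c) /\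
    `|'D_(Defs.basis c) u x - coef c (grad0 u)| <= eta / K.
  by move=> xd; apply: Hd; rewrite /= sub0r normrN.
apply/nbhs_normP; exists delta => // x /=; rewrite sub0r normrN => xdelta v.
(* [h * S] bounds the length of the coordinatewise path from [x] to [x + h *: v]; below, [S + 1]
   gives a positive divisor. *)
pose S : R := \sum_(c <- coords n) `|coef c v| * `|Defs.basis c : heis R n|.
have S0 : 0 <= S by apply: sumr_ge0 => c _; rewrite mulr_ge0.
have S1 : 0 < S + 1 by rewrite ltr_wpDl.
near=> h.
have h0 : 0 < h by near: h; exact: nbhs_right_gt.
have hS : `|x| + h * S < delta.
  have hd : h * (S + 1) < delta - `|x|.
    rewrite -ltr_pdivlMr//; near: h; apply: nbhs_right_lt.
    by rewrite divr_gt0 ?subr_gt0.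
  rewrite -ltrBrDl; apply: le_lt_trans hd.
  by rewrite ler_wpM2l ?lerDl ?(ltW h0).
have := @multi_increment_le R _ _ _ u _ delta _ H (coords n)
  (fun c => h * coef c v) x.
under eq_bigr do rewrite normrM (gtr0_norm h0) -mulrA.
rewrite -mulr_sumr => /(_ hS).
under eq_bigr do rewrite -scalerA.
rewrite -scaler_sumr sum_coef_basis.
under eq_bigr do rewrite -mulrA.
rewrite -mulr_sumr.
under eq_bigr do rewrite mulrC.
rewrite -/(dot (grad0 u) v) => /le_trans; apply.
under eq_bigr do rewrite normrM (gtr0_norm h0).
rewrite -mulr_sumr.
rewrite mulrCA ler_wpM2l ?(ltW h0)// -mulrA ler_wpM2l ?(ltW eta0)//.
rewrite mulrC ler_pdivrMr// mulrC.
apply: (@le_trans _ _ (\sum_(c <- coords n) hnorm v)).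
  by apply: ler_sum => c _; exact: coef_le_hnorm.
rewrite big_const_seq count_predT iter_addr_0 -mulr_natl.
by rewrite ler_wpM2r ?sqrtr_ge0// ler_nat.
Unshelve. all: by end_near. Qed.

(** * An approximate Lagrange multiplier rule *)

Lemma hnormD (R : realType) n (P Q : heis R n) : dot P Q = 0 ->
  hnorm (P + Q) <= hnorm P + hnorm Q.
Proof.
move=> PQ0; rewrite -(@ler_pXn2r _ 2) ?nnegrE ?addr_ge0 ?sqrtr_ge0//.
rewrite sqrrD !sqr_sqrtr ?dot_ge0// dotDl !dotDr (dotC Q P) PQ0.
have := mulr_ge0 (sqrtr_ge0 (dot P P)) (sqrtr_ge0 (dot Q Q)).
rewrite /hnorm; lra.
Qed.

Lemma hnormZ (R : realType) n (a : R) (P : heis R n) :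
  hnorm (a *: P) = `|a| * hnorm P.
Proof.
by rewrite /hnorm dotZl dotZr mulrA -expr2 sqrtrM ?sqr_ge0// sqrtr_sqr.
Qed.

(* Test with [v = w - sigma g], sigma -> 0, where [w] is the component of [l]
   orthogonal to [g], and with [v = - g]. *)
Lemma near_positive_multiple (R : realType) n (l g : heis R n) (eta : R) :
  0 < eta -> 0 < dot g g -> eta ^+ 2 *+ 2 < dot l l ->
  (forall v, dot g v < 0 -> dot l v <= eta * hnorm v) ->
  0 < dot l g / dot g g /\ hnorm (l - (dot l g / dot g g) *: g) <= eta.
Proof.
move=> eta0 g0 l0 H.
set lam := dot l g / dot g g; set w := l - lam *: g.
have lamE : lam * dot g g = dot l g by rewrite divfK ?gt_eqF.
have wg : dot w g = 0 by rewrite dotDl -scaleNr dotZl mulNr lamE subrr.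
have lE : l = w + lam *: g by rewrite subrK.
clearbody w.
have lw : dot l w = dot w w.
  by rewrite {1}lE dotDl dotZl (dotC g) wg mulr0 addr0.
have ww : hnorm w ^+ 2 = dot w w by rewrite sqr_sqrtr ?dot_ge0.
have gg : hnorm g ^+ 2 = dot g g by rewrite sqr_sqrtr ?dot_ge0.
have hg0 : 0 < hnorm g by rewrite sqrtr_gt0.
have hw0 : 0 <= hnorm w by exact: sqrtr_ge0.
have test_w : hnorm w <= eta.
  have sq_le : hnorm w ^+ 2 <= eta * hnorm w.
    (* With [sigma = e / M], the terms that [sigma *: g] adds to the inequality total at most [e],
       and [e] is arbitrary. *)
    pose M := `|dot l g + eta * hnorm g| + 1.
    have M0 : 0 < M by rewrite ltr_wpDl.
    apply/ler_addgt0Pr => e e0.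
    pose sigma := e / M.
    have s0 : 0 < sigma by rewrite divr_gt0.
    have := H (w - sigma *: g).
    rewrite -scaleNr !dotDr !dotZr (dotC g w) wg add0r mulNr oppr_lt0.
    rewrite mulr_gt0// => /(_ isT); rewrite lw -ww => h1.
    have h2 : hnorm (w + - sigma *: g) <= hnorm w + sigma * hnorm g.
      rewrite -[sigma in X in _ <= X](gtr0_norm s0) -normrN -hnormZ hnormD//.
      by rewrite dotZr wg mulr0.
    have h3 : eta * hnorm (w + - sigma *: g)
        <= eta * (hnorm w + sigma * hnorm g) by rewrite ler_pM2l.
    have h4 : sigma * (dot l g + eta * hnorm g) <= e.
      apply: (@le_trans _ _ (sigma * M)); last by rewrite divfK ?gt_eqF.
      by rewrite ler_pM2l// (le_trans (ler_norm _))// lerDl.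
    by move: h1 h3 h4; rewrite mulNr !mulrDr; lra.
  by have [->|w0] := eqVneq (hnorm w) 0; [exact: ltW|
    rewrite -(@ler_pM2r _ (hnorm w)) ?lt0r ?w0// -expr2].
split=> //.
have test_g : - dot l g <= eta * hnorm g.
  have := H (- g); rewrite -scaleN1r hnormZ normrN1 mul1r !dotZr !mulN1r.
  by rewrite oppr_lt0 => /(_ g0).
have ll : dot l l = dot w w + lam ^+ 2 * dot g g.
  rewrite lE dotDl !dotDr !dotZl !dotZr (dotC g w) wg; ring.
have lamg : - eta <= lam * hnorm g.
  rewrite -(ler_pM2r hg0) -mulrA -expr2 gg lamE; lra.
(* If [lam <= 0], both orthogonal components of [l] have length at most [eta], so [dot l l] is at
   most twice [eta ^+ 2], against the hypothesis. *)
rewrite ltNge; apply/negP => lam0.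
have lamg0 : lam * hnorm g <= 0 by rewrite mulr_le0_ge0// ltW.
have sq1 : (lam * hnorm g) ^+ 2 <= eta ^+ 2.
  by rewrite -sqrrN lerXn2r ?nnegrE ?oppr_ge0 ?(ltW eta0)//; lra.
have sq2 : hnorm w ^+ 2 <= eta ^+ 2 by rewrite lerXn2r ?nnegrE ?(ltW eta0).
by move: sq1 sq2; rewrite exprMn gg ww; lra.
Qed.

(** * The fourth power N of the gauge, its level sets and its gradient *)

Definition quart (R : realType) n (P : heis R n) : R :=
  (dot P P - tc P ^+ 2) ^+ 2 + tc P ^+ 2.

Lemma enorm_horiz_sqr (R : realType) n (P : heis R n) :
  enorm (horiz P) ^+ 2 = dot P P - tc P ^+ 2.
Proof.
rewrite sqr_sqrtr ?sumr_ge0// => [|i _]; last exact: sqr_ge0.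
rewrite /dot sum_coords /= expr2 addrK big_split_ord /=.
by congr (_ + _); apply: eq_bigr => i _; rewrite (row_mxEl, row_mxEr) expr2.
Qed.

Lemma quartE (R : realType) n (P : heis R n) :
  quart P = enorm (horiz P) ^+ 4 + tc P ^+ 2.
Proof. by rewrite /quart -enorm_horiz_sqr -exprM. Qed.

Lemma gauge_pow4 (R : realType) n (P : heis R n) : gauge P ^+ 4 = quart P.
Proof.
have sE : enorm (xc P) ^+ 2 + enorm (yc P) ^+ 2 = dot P P - tc P ^+ 2.
  rewrite !sqr_sqrtr ?sumr_ge0// => [|i _|i _]; [|exact: sqr_ge0..].
  rewrite /dot sum_coords /= expr2 addrK.
  by congr (_ + _); apply: eq_bigr => i _; rewrite expr2.
rewrite /gauge sE -/(quart P) -powR_mulrn ?powR_ge0// -powRrM mulVf ?pnatr_eq0//.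
by rewrite powRr1// addr_ge0 ?sqr_ge0.
Qed.

Lemma hballE (R : realType) n (eps : R) : 0 < eps ->
  hball eps = [set P : heis R n | quart P < eps ^+ 4].
Proof.
move=> e0; apply/seteqP; split=> P; rewrite /hball /= -gauge_pow4.
  by rewrite ltr_pXn2r// nnegrE ?powR_ge0// ltW.
by rewrite ltr_pXn2r// nnegrE ?powR_ge0// ltW.
Qed.

Lemma coef_continuous (R : realType) n c : continuous (@coef R n c).
Proof.
move=> P; case: c => [i|i|].
- apply: (@continuous_comp _ _ _ (fun Q : heis R n => Q.1.1)
    (fun v : 'rV[R]_n => v 0 i)); last exact: coord_continuous.
  by apply: (@continuous_comp _ _ _ fst fst); exact: cvg_fst.
- apply: (@continuous_comp _ _ _ (fun Q : heis R n => Q.1.2)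
    (fun v : 'rV[R]_n => v 0 i)); last exact: coord_continuous.
  by apply: (@continuous_comp _ _ _ fst snd); [exact: cvg_fst|exact: cvg_snd].
- exact: cvg_snd.
Qed.

Lemma quart_continuous (R : realType) n : continuous (@quart R n).
Proof.
have dotc : continuous (fun P : heis R n => dot P P).
  apply: continuous_big; first exact: add_continuous.
  by move=> c _ P; apply: continuousM; exact: coef_continuous.
have tc2 : continuous (fun P : heis R n => tc P ^+ 2).
  by move=> P; apply: continuousM; exact: (coef_continuous (c := CoordT)).
have hc : continuous (fun P : heis R n => dot P P - tc P ^+ 2).
  by move=> P; apply: cvgB; [exact: dotc|exact: tc2].
move=> P; apply: (@cvgD _ _ _ _ _ (fun P => (dot P P - tc P ^+ 2) ^+ 2)).
  by apply: (@cvgM _ _ _ _ (fun P => dot P P - tc P ^+ 2)); exact: hc.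
exact: tc2.
Qed.

(** By continuity of N, the closure lies in the closed sublevel set, while the open sublevel set is
    its own interior. *)
Lemma boundary_hball (R : realType) n (eps : R) (P : heis R n) : 0 < eps ->
  boundary (hball eps) P -> quart P = eps ^+ 4.
Proof.
move=> e0; rewrite (hballE _ e0) => -[clP intP].
apply/eqP; rewrite eq_le; apply/andP; split.
  have cl : closed [set Q : heis R n | quart Q <= eps ^+ 4].
    apply: (@preimage_closed _ _ _ [set r | r <= _]); last exact: closed_le.
    by move=> Q _; exact: quart_continuous.
  by apply: cl; apply: closureS clP => Q /=; exact: ltW.
have : open [set Q : heis R n | quart Q < eps ^+ 4].
  by apply: (@open_comp _ _ _ [set r | r < _]); [move=> Q _; exact: quart_continuous|exact: open_lt].
move/interior_id => iE; rewrite leNgt; apply/negP => Plt.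
by apply: intP; rewrite iE.
Qed.

Definition qgrad (R : realType) n (P : heis R n) : heis R n :=
  (4 * (dot P P - tc P ^+ 2)) *: (xc P, yc P, 0) + (2 * tc P) *: (0, 0, 1).

Lemma dot_qgrad (R : realType) n (P v : heis R n) :
  dot (qgrad P) v =
  4 * (dot P P - tc P ^+ 2) * (dot P v - tc P * tc v) + 2 * tc P * tc v.
Proof.
have E1 : dot (xc P, yc P, 0) v = dot P v - tc P * tc v.
  by rewrite /dot !sum_coords /= mul0r addr0 addrK.
have E2 : dot (0, 0, 1) v = tc v.
  rewrite /dot !sum_coords /= !big1 ?add0r ?mul1r// => i _;
  by rewrite mxE mul0r.
by rewrite dotDl !dotZl E1 E2.
Qed.

(** N along the ray is a polynomial of degree 4 in [h] whose linear coefficient is the negative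
    number [dot (qgrad P) v]. *)
Lemma quart_decr (R : realType) n (P v : heis R n) : dot (qgrad P) v < 0 ->
  \forall h \near 0^'+, quart (P + h *: v) < quart P.
Proof.
set D := dot _ _ => D0.
(* The squared horizontal length of [P + h *: v] is [s + 2 h B + h^2 C]. Hence [K1], [K2] and
   [C ^+ 2] are the coefficients of [h^2], [h^3] and [h^4] in N, and [K] bounds their combined
   effect when [h < 1]. *)
pose s := dot P P - tc P ^+ 2; pose B := dot P v - tc P * tc v.
pose C := dot v v - tc v ^+ 2; pose K1 := 4 * B ^+ 2 + 2 * s * C + tc v ^+ 2.
pose K2 := 4 * B * C; pose K := `|K1| + `|K2| + `|C ^+ 2| + 1.
have K0 : 0 < K by rewrite ltr_wpDl// !addr_ge0.
near=> h.
have h0 : 0 < h by near: h; exact: nbhs_right_gt.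
have h1 : h < 1 by near: h; exact: nbhs_right_lt.
have hD : h < - D / K by near: h; apply: nbhs_right_lt; rewrite divr_gt0 ?oppr_gt0.
have E : quart (P + h *: v) - quart P
    = h * (D + h * (K1 + h * K2 + h * h * C ^+ 2)).
  rewrite /D dot_qgrad /quart !dotDl !dotDr !dotZl !dotZr (dotC v P).
  have -> : tc (P + h *: v) = tc P + h * tc v by [].
  by rewrite /K1 /K2 /B /C /s; ring.
rewrite -subr_lt0 E pmulr_rlt0//.
rewrite ltr_pdivlMr// in hD.
have bound : K1 + h * K2 + h * h * C ^+ 2 <= K.
  have b1 : h * K2 <= `|K2|.
    rewrite (le_trans (ler_norm _))// normrM ger0_norm ?(ltW h0)//.
    by rewrite ler_piMl// ltW.
  have b2 : h * h * C ^+ 2 <= `|C ^+ 2|.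
    rewrite ger0_norm ?sqr_ge0// ler_piMl ?sqr_ge0//.
    by rewrite mulr_ile1// ltW.
  by have := ler_norm K1; rewrite /K; lra.
have : h * (K1 + h * K2 + h * h * C ^+ 2) <= h * K by rewrite ler_pM2l.
lra.
Unshelve. all: by end_near. Qed.

(** Pairing the gradient with [P] itself gives [4 s^2 + 2 t^2], where [s] is the squared horizontal
    length; this vanishes only if N does. *)
Lemma quart_gt0_qgrad (R : realType) n (P : heis R n) : 0 < quart P ->
  0 < dot (qgrad P) (qgrad P).
Proof.
move=> P0; rewrite lt0r dot_ge0 andbT; apply/eqP => g0.
have gc0 c : coef c (qgrad P) = 0.
  have := coef_sqr_le_dot c (qgrad P).
  by rewrite g0 le_eqVlt ltNge sqr_ge0 orbF sqrf_eq0 => /eqP.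
have : dot (qgrad P) P = 0 by apply: big1 => c _; rewrite gc0 mul0r.
rewrite dot_qgrad; move: P0; rewrite /quart.
have := sqr_ge0 (dot P P - tc P ^+ 2); have := sqr_ge0 (tc P).
set s := dot P P - _.
have -> : 4 * s * (dot P P - tc P * tc P) = 4 * s ^+ 2 by rewrite /s; ring.
lra.
Qed.

(** Brings the extremal points into any neighbourhood of 0. As [eps <= 1], both the squared
    horizontal length and [t^2 <= eps^4] are at most [eps^2], so [dot P P <= 2 eps^2]. *)
Lemma norm_le_of_quart (R : realType) n (P : heis R n) (eps : R) :
  0 < eps <= 1 -> quart P = eps ^+ 4 -> `|P| <= 2 * eps.
Proof.
move=> /andP[e0 e1] qP; apply: (le_trans (norm_le_hnorm P)).
have e20 : 0 < 2 * eps by rewrite mulr_gt0.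
rewrite -(@ler_pXn2r _ 2) ?nnegrE ?sqrtr_ge0 ?(ltW e20)//.
rewrite sqr_sqrtr ?dot_ge0//.
have s0 : 0 <= dot P P - tc P ^+ 2 by rewrite -enorm_horiz_sqr sqr_ge0.
have se : dot P P - tc P ^+ 2 <= eps ^+ 2.
  rewrite -(@ler_pXn2r _ 2) ?nnegrE ?sqr_ge0// -exprM -qP.
  by rewrite lerDl sqr_ge0.
have te : tc P ^+ 2 <= eps ^+ 4 by rewrite -qP lerDr sqr_ge0.
have e4 : eps ^+ 4 <= eps ^+ 2.
  by rewrite ler_wiXn2l ?(ltW e0).
by rewrite exprMn; have := sqr_ge0 eps; lra.
Qed.

(** * The multiplier equation at maximum points on gauge spheres *)

Lemma strict_diff0N (R : realType) n (u : heis R n -> R) (l : heis R n) :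
  strict_diff0 u l -> strict_diff0 (fun P => - u P) (- l).
Proof.
move=> H eta /H; apply: filterS => x Hx v; apply: filterS (Hx v) => h.
rewrite -[- l]scaleN1r dotZl; apply: le_trans; rewrite -normrN.
by rewrite le_eqVlt; apply/orP; left; apply/eqP; congr `|_|; ring.
Qed.

(** A direction [v] with [dot (qgrad P) v < 0] enters the ball, where [u] is at most [u P]; strict
    differentiability turns this into [dot l v <= eta * hnorm v], the hypothesis of
    [near_positive_multiple]. *)
Lemma sphere_max_multiplier (R : realType) n (u : heis R n -> R)
    (l : heis R n) (Pe : R -> heis R n) (eta : R) :
  strict_diff0 u l -> 0 < eta -> eta ^+ 2 *+ 2 < dot l l ->
  (\forall eps \near 0^'+, boundary (hball eps) (Pe eps) /\
     (forall Q, closure (hball eps) Q -> u Q <= u (Pe eps))) ->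
  \forall eps \near 0^'+,
    0 < dot l (qgrad (Pe eps)) / dot (qgrad (Pe eps)) (qgrad (Pe eps)) /\
    hnorm (l - (dot l (qgrad (Pe eps)) / dot (qgrad (Pe eps)) (qgrad (Pe eps)))
                *: qgrad (Pe eps)) <= eta.
Proof.
move=> du eta0 l0 maxP.
have /nbhs_normP[delta /= delta0 Hd] := du _ eta0.
near=> eps.
have e0 : 0 < eps by near: eps; exact: nbhs_right_gt.
have e1 : eps < 1 by near: eps; exact: nbhs_right_lt.
have ed : eps < delta / 2.
  by near: eps; apply: nbhs_right_lt; rewrite divr_gt0.
have [bP uP] : boundary (hball eps) (Pe eps) /\
    (forall Q, closure (hball eps) Q -> u Q <= u (Pe eps)) by near: eps.
move: (Pe eps) bP uP => P bP uP.
have qP := boundary_hball e0 bP.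
apply: near_positive_multiple => //.
  by rewrite quart_gt0_qgrad// qP exprn_gt0.
move=> v gv.
have Pd : `|P| < delta.
  apply: (@le_lt_trans _ _ (2 * eps)).
    by apply: norm_le_of_quart; rewrite // e0 ltW.
  by rewrite mulrC -ltr_pdivlMr.
have dP : \forall h \near 0^'+,
    `|u (P + h *: v) - u P - h * dot l v| <= h * (eta * hnorm v).
  by apply: Hd; rewrite /= sub0r normrN.
(* A single small [h] serves both the expansion of [u] and the decrease of N. *)
have [h [h0 [hd hq]]] : exists h : R, 0 < h /\
    (`|u (P + h *: v) - u P - h * dot l v| <= h * (eta * hnorm v) /\
     quart (P + h *: v) < quart P).
  apply: (@filter_ex _ (0^'+ : set_system R)).
  by apply: filterI; [exact: nbhs_right_gt|apply: filterI => //; exact: quart_decr].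
have : u (P + h *: v) <= u P.
  by apply: uP; apply: subset_closure; rewrite hballE //= -qP.
move: hd; rewrite ler_norml => /andP[h1 _] h2.
rewrite -(ler_pM2l h0); lra.
Unshelve. all: by end_near. Qed.

(** * Convergence of row vectors, Euclidean norms and horizontal parts *)

Lemma cvg_rV (T : Type) (F : set_system T) (FF : Filter F) (R : realType) m
    (f : T -> 'rV[R]_m) (v : 'rV[R]_m) :
  (forall i, f x 0 i @[x --> F] --> v 0 i) -> f x @[x --> F] --> v.
Proof.
move=> fv; apply/cvgrPdist_le => e e0.
have H : \forall x \near F, forall i, `|v 0 i - f x 0 i| <= e.
  by apply: filter_forall => i; move/cvgrPdist_le: (fv i); exact.
by apply: filterS H => x H; apply: rV_norm_le => [|i]; [exact: ltW|rewrite !mxE].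
Qed.

Lemma enorm_continuous (R : realType) m : continuous (@enorm R m).
Proof.
have sumc : continuous (fun w : 'rV[R]_m => \sum_i w 0 i ^+ 2).
  apply: continuous_big; first exact: add_continuous.
  by move=> i _ w; apply: continuousM; exact: coord_continuous.
by move=> v; apply: continuous_comp; [exact: sumc|exact: sqrt_continuous].
Qed.

Lemma enormZ (R : realType) m (a : R) (v : 'rV[R]_m) :
  enorm (a *: v) = `|a| * enorm v.
Proof.
rewrite /enorm; under eq_bigr do rewrite mxE exprMn.
by rewrite -mulr_sumr sqrtrM ?sqr_ge0// sqrtr_sqr.
Qed.

Lemma enorm_gt0 (R : realType) m (v : 'rV[R]_m) : v != 0 -> 0 < enorm v.
Proof.
move=> v0; rewrite sqrtr_gt0 lt0r sumr_ge0 => [|i _]; last exact: sqr_ge0.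
rewrite andbT; apply: contra v0 => /eqP s0; apply/eqP/rowP => i.
have /allP/(_ i) := etrans (esym (psumr_eq0 _ (fun i _ => sqr_ge0 (v 0 i))))
  (introT eqP s0).
by rewrite mem_index_enum mxE sqrf_eq0 => /(_ isT)/eqP.
Qed.

Lemma coef_horiz_le (R : realType) n (P : heis R n) i :
  `|horiz P 0 i| <= hnorm P.
Proof.
rewrite /horiz; case: (splitP i) => j ij.
  by rewrite (_ : i = lshift n j) ?row_mxEl ?(coef_le_hnorm (CoordX j))//; exact/val_inj.
by rewrite (_ : i = rshift n j) ?row_mxEr ?(coef_le_hnorm (CoordY j))//; exact/val_inj.
Qed.

Lemma horizB (R : realType) n (P Q : heis R n) :
  horiz (P - Q) = horiz P - horiz Q.
Proof. by rewrite /horiz opp_row_mx add_row_mx. Qed.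

Lemma horizZ (R : realType) n (a : R) (P : heis R n) :
  horiz (a *: P) = a *: horiz P.
Proof. by rewrite /horiz scale_row_mx. Qed.

Lemma horiz_qgrad (R : realType) n (P : heis R n) :
  horiz (qgrad P) = (4 * enorm (horiz P) ^+ 2) *: horiz P.
Proof.
by rewrite enorm_horiz_sqr /qgrad /horiz /xc /yc/= !scaler0 !addr0 scale_row_mx.
Qed.

Lemma tc_qgrad (R : realType) n (P : heis R n) : tc (qgrad P) = 2 * tc P.
Proof.
rewrite /qgrad /tc /=.
by rewrite -[X in X + _]/(_ * 0) -[X in _ + X]/(_ * 1) mulr0 mulr1 add0r.
Qed.

(** * Asymptotics deduced from the multiplier equation *)

Section MultiplierLimits.
Context {T : Type} {F : set_system T} {FF : ProperFilter F}.
Context {R : realType} {m : nat}.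
(** [z] and [t] stand for the horizontal and vertical parts of the extremal point; [za] and [tb] are
    the two components of [lam] grad N tending to [(a, b)]. *)
Variables (eps lam t : T -> R) (z : T -> 'rV[R]_m) (a : 'rV[R]_m) (b : R).
Hypothesis a_neq0 : a != 0.
Hypothesis eps0 : eps x @[x --> F] --> 0.
Hypothesis eps_gt0 : \forall x \near F, 0 < eps x.
Hypothesis lam_gt0 : \forall x \near F, 0 < lam x.
Hypothesis sphere : \forall x \near F, enorm (z x) ^+ 4 + t x ^+ 2 = eps x ^+ 4.
Hypothesis za : lam x *: ((4 * enorm (z x) ^+ 2) *: z x) @[x --> F] --> a.
Hypothesis tb : lam x * (2 * t x) @[x --> F] --> b.

Let r x := enorm (z x).

(** Take Euclidean norms in [za]. *)
Let cvg_lam_r3 : 4 * lam x * r x ^+ 3 @[x --> F] --> enorm a.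
Proof.
apply: cvg_trans (cvg_comp _ _ za (@enorm_continuous R m a)).
apply: near_eq_cvg; apply: filterS lam_gt0 => x l0 /=.
have r0 : 0 <= r x by exact: sqrtr_ge0.
rewrite !enormZ (gtr0_norm l0) ger0_norm ?mulr_ge0 ?sqr_ge0// -/(r x).
by ring.
Qed.

Let lam_r3_gt0 : \forall x \near F, 0 < 4 * lam x * r x ^+ 3.
Proof. exact: cvgr_gt cvg_lam_r3 _ (enorm_gt0 a_neq0). Qed.

(** Extremal points eventually leave the t-axis, as [4 lam r^3] has a positive limit; this licenses
    the divisions by [r]. *)
Let r_gt0 : \forall x \near F, 0 < r x.
Proof.
apply: filterS lam_r3_gt0 => x.
have r0 : 0 <= r x by exact: sqrtr_ge0.
by move: r0; rewrite le_eqVlt => /predU1P[<-|//]; rewrite expr0n mulr0 ltxx.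
Qed.

(** Dividing [za] by [4 lam r^3] cancels the unknown multiplier. *)
Let cvg_direction : (r x)^-1 *: z x @[x --> F] --> (enorm a)^-1 *: a.
Proof.
have inv : (4 * lam x * r x ^+ 3)^-1 @[x --> F] --> (enorm a)^-1.
  by apply: cvgV cvg_lam_r3; rewrite gt_eqF ?enorm_gt0.
apply: cvg_trans (cvgZ inv za); apply: near_eq_cvg.
apply: filterS2 lam_gt0 r_gt0 => x l0 r0 /=.
rewrite !scalerA -/(r x); congr (_ *: _); field.
by rewrite !gt_eqF.
Qed.

(** Again [lam] cancels: twice [2 lam t] over [4 lam r^3] is [t / r^3], the source of the factor 2
    in the limit. *)
Let cvg_t_r3 : t x / r x ^+ 3 @[x --> F] --> 2 * b / enorm a.
Proof.
have inv : (4 * lam x * r x ^+ 3)^-1 @[x --> F] --> (enorm a)^-1.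
  by apply: cvgV cvg_lam_r3; rewrite gt_eqF ?enorm_gt0.
have two : (2 : R) @[x --> F] --> (2 : R) by exact: cvg_cst.
apply: cvg_trans (cvgM (cvgM two tb) inv); apply: near_eq_cvg.
apply: filterS2 lam_gt0 r_gt0 => x l0 r0 /=.
by field; rewrite !gt_eqF.
Qed.

Let r_le_eps : \forall x \near F, r x <= eps x.
Proof.
apply: filterS2 sphere eps_gt0 => x rt e0.
rewrite -(@ler_pXn2r _ 4) ?nnegrE ?sqrtr_ge0 ?(ltW e0)//.
by rewrite -rt lerDl sqr_ge0.
Qed.

Let cvg_r0 : r x @[x --> F] --> 0.
Proof.
apply: (squeeze_cvgr _ (cvg_cst 0) eps0).
by apply: filterS r_le_eps => x ->; rewrite sqrtr_ge0.
Qed.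

(* [(eps / r)^4 = 1 + (t / r^3)^2 r^2], and [t / r^3] stays bounded. *)
Let cvg_ratio : r x / eps x @[x --> F] --> (1 : R).
Proof.
have one : (1 : R) @[x --> F] --> (1 : R) by exact: cvg_cst.
have c0 : 1 + (t x / r x ^+ 3) ^+ 2 * r x ^+ 2 @[x --> F] --> (1 : R).
  have := cvgD one (cvgM (cvgM cvg_t_r3 cvg_t_r3) (cvgM cvg_r0 cvg_r0)).
  by rewrite !mulr0 addr0; exact.
have c1 : (1 + (t x / r x ^+ 3) ^+ 2 * r x ^+ 2)^-1 @[x --> F] --> (1^-1 : R).
  by apply: cvgV c0; exact: oner_neq0.
rewrite invr1 in c1.
(* The ratio [r / eps] lies in [0, 1], hence between its own fourth power and 1; that fourth power
   is the inverse in [c1]. *)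
apply: (squeeze_cvgr _ c1 one).
near=> x.
have e0 : 0 < eps x by near: x.
have r0 : 0 < r x by near: x.
have re : r x <= eps x by near: x.
have rt : r x ^+ 4 + t x ^+ 2 = eps x ^+ 4 by near: x.
have le1 : r x / eps x <= 1 by rewrite ler_pdivrMr// mul1r.
rewrite le1 andbT.
have -> : (1 + (t x / r x ^+ 3) ^+ 2 * r x ^+ 2)^-1 = (r x / eps x) ^+ 4.
  have -> : 1 + (t x / r x ^+ 3) ^+ 2 * r x ^+ 2 = eps x ^+ 4 / r x ^+ 4.
    by rewrite -rt; field; rewrite gt_eqF.
  by rewrite expr_div_n invf_div.
have ge0 : 0 <= r x / eps x by rewrite divr_ge0 ?ltW.
by rewrite exprS ler_piMr// exprn_ile1.
Unshelve. all: by end_near. Qed.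

Lemma multiplier_cvg_horiz :
  (eps x)^-1 *: z x @[x --> F] --> (enorm a)^-1 *: a.
Proof.
rewrite -[X in _ --> X]scale1r.
apply: cvg_trans (cvgZ cvg_ratio cvg_direction); apply: near_eq_cvg.
apply: filterS2 eps_gt0 r_gt0 => x e0 r0 /=.
by rewrite scalerA; congr (_ *: _); field; rewrite !gt_eqF.
Qed.

Lemma multiplier_cvg_vert :
  `|t x| / eps x ^+ 3 @[x --> F] --> 2 * `|b| / enorm a.
Proof.
(* The limit is put in the shape of [t / eps^3 = (t / r^3) (r / eps)^3]. *)
have -> : 2 * `|b| / enorm a = `|2 * b / enorm a * (1 * (1 * 1))|.
  by rewrite !mulr1 !normrM normfV normr_nat (gtr0_norm (enorm_gt0 a_neq0)).
apply: cvg_trans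
  (cvg_norm (cvgM cvg_t_r3 (cvgM cvg_ratio (cvgM cvg_ratio cvg_ratio)))).
apply: near_eq_cvg.
apply: filterS2 eps_gt0 r_gt0 => x e0 r0 /=.
have -> : t x / r x ^+ 3 * (r x / eps x * (r x / eps x * (r x / eps x)))
    = t x / eps x ^+ 3 by field; rewrite !gt_eqF.
by rewrite normrM normfV (ger0_norm (exprn_ge0 _ (ltW e0))).
Qed.

End MultiplierLimits.

(** * Limits for maxima, then for minima *)

Lemma sphere_max_limits (R : realType) n (u : heis R n -> R)
    (l : heis R n) (Pe : R -> heis R n) :
  strict_diff0 u l -> horiz l != 0 ->
  (\forall eps \near 0^'+, boundary (hball eps) (Pe eps) /\
     (forall Q, closure (hball eps) Q -> u Q <= u (Pe eps))) ->
  eps^-1 *: horiz (Pe eps) @[eps --> 0^'+]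
    --> (enorm (horiz l))^-1 *: horiz l /\
  `|tc (Pe eps)| / eps ^+ 3 @[eps --> 0^'+]
    --> 2 * `|tc l| / enorm (horiz l).
Proof.
move=> du l0 maxP.
(* This multiplier does not depend on [eta], so the estimates for all [eta] concern one function and
   amount to a limit. *)
pose lam eps := dot l (qgrad (Pe eps)) / dot (qgrad (Pe eps)) (qgrad (Pe eps)).
have ll0 : 0 < dot l l.
  have := enorm_horiz_sqr l; have := exprn_gt0 2 (enorm_gt0 l0).
  by have := sqr_ge0 (tc l); lra.
have mult (eta : R) : 0 < eta -> \forall eps \near 0^'+,
    0 < lam eps /\ hnorm (l - lam eps *: qgrad (Pe eps)) <= eta.
  (* Capping at half the length of [l] makes [2 eta'^2] at most half of [dot l l], as the multiplier
     rule requires. *)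
  move=> eta0; pose eta' := Num.min eta (Num.sqrt (dot l l) / 2).
  have s0 : 0 < Num.sqrt (dot l l) by rewrite sqrtr_gt0.
  have eta'0 : 0 < eta' by rewrite lt_min eta0 divr_gt0.
  have small : eta' ^+ 2 *+ 2 < dot l l.
    have : eta' ^+ 2 <= (Num.sqrt (dot l l) / 2) ^+ 2.
      by rewrite lerXn2r ?nnegrE ?(ltW eta'0) ?divr_ge0 ?(ltW s0)// ge_min lexx orbT.
    by rewrite expr_div_n sqr_sqrtr ?(ltW ll0)//; lra.
  apply: filterS (sphere_max_multiplier du eta'0 small maxP) => eps [? h].
  by split=> //; apply: le_trans h _; rewrite ge_min lexx.
have eps_gt0 : \forall eps \near 0^'+, 0 < (eps : R) by exact: nbhs_right_gt.
have eps0 : (eps : R) @[eps --> 0^'+] --> (0 : R).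
  exact: cvg_at_right_filter (@cvg_id _ (nbhs (0 : R))).
have lam_gt0 : \forall eps \near 0^'+, 0 < lam eps.
  by apply: filterS (mult 1 ltr01) => eps [].
have sphere : \forall eps \near 0^'+,
    enorm (horiz (Pe eps)) ^+ 4 + tc (Pe eps) ^+ 2 = eps ^+ 4.
  apply: filterS2 eps_gt0 maxP => eps e0 [bP _].
  by rewrite -quartE; exact: boundary_hball.
have za : lam eps *: ((4 * enorm (horiz (Pe eps)) ^+ 2) *: horiz (Pe eps))
    @[eps --> 0^'+] --> horiz l.
  apply: cvg_rV => i; apply/cvgrPdist_le => e /mult; apply: filterS => eps [_].
  apply: le_trans; rewrite -horiz_qgrad -horizZ.
  by apply: le_trans (coef_horiz_le _ i); rewrite horizB !mxE.
have tb : lam eps * (2 * tc (Pe eps)) @[eps --> 0^'+] --> tc l.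
  apply/cvgrPdist_le => e /mult; apply: filterS => eps [_].
  apply: le_trans; rewrite -tc_qgrad.
  exact: (coef_le_hnorm CoordT (l - lam eps *: qgrad (Pe eps))).
split; first exact: multiplier_cvg_horiz l0 eps0 eps_gt0 lam_gt0 sphere za tb.
exact: multiplier_cvg_vert l0 eps0 eps_gt0 lam_gt0 sphere za tb.
Qed.

(** At the origin the coefficients [2 y_i] and [- 2 x_i] vanish, so X_i and Y_i reduce to plain
    partial derivatives. *)
Lemma horiz_grad0 (R : realType) n (u : heis R n -> R) :
  horiz (grad0 u) = hgrad u 0.
Proof.
rewrite /horiz /hgrad; congr row_mx; apply/rowP => i.
  by rewrite !mxE /Xfield !mxE mulr0 mul0r addr0.
by rewrite !mxE /Yfield !mxE mulr0 mul0r subr0.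
Qed.

Theorem lemma3p2 (R : realType) (n : nat) (n_ge1 : (1 <= n)%N)
  (U : set (heis R n)) (u : heis R n -> R)
  (openU : open U) (U0 : U 0) (smooth_u : smooth_on U u)
  (grad_neq0 : hgrad u 0 != 0)
  (PM Pm : R -> heis R n)
  (PM_max : \forall eps \near 0^'+,
     boundary (hball eps) (PM eps) /\
     (forall Q, closure (hball eps) Q -> u Q <= u (PM eps)))
  (Pm_min : \forall eps \near 0^'+,
     boundary (hball eps) (Pm eps) /\
     (forall Q, closure (hball eps) Q -> u (Pm eps) <= u Q)) :
  [/\ eps^-1 *: horiz (PM eps) @[eps --> 0^'+]
        --> (enorm (hgrad u 0))^-1 *: hgrad u 0,
      eps^-1 *: horiz (Pm eps) @[eps --> 0^'+]
        --> - ((enorm (hgrad u 0))^-1 *: hgrad u 0),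
      `|tc (PM eps)| / eps ^+ 3 @[eps --> 0^'+]
        --> 2 * `|partial CoordT u 0| / enorm (hgrad u 0) &
      `|tc (Pm eps)| / eps ^+ 3 @[eps --> 0^'+]
        --> 2 * `|partial CoordT u 0| / enorm (hgrad u 0)].
Proof.
have du := smooth_strict_diff0 openU U0 smooth_u.
have dNu := strict_diff0N du.
have l0 : horiz (grad0 u) != 0 by rewrite horiz_grad0.
have [hM tM] := sphere_max_limits du l0 PM_max.
have horizN (P : heis R n) : horiz (- P) = - horiz P.
  by rewrite /horiz opp_row_mx.
have enormN m (v : 'rV[R]_m) : enorm (- v) = enorm v.
  by rewrite -scaleN1r enormZ normrN1 mul1r.
have Nl0 : horiz (- grad0 u) != 0 by rewrite horizN oppr_eq0.
have Pm_max : \forall eps \near 0^'+, boundary (hball eps) (Pm eps) /\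
    (forall Q, closure (hball eps) Q -> - u Q <= - u (Pm eps)).
  by apply: filterS Pm_min => eps [bP H]; split=> // Q /H; rewrite lerN2.
have [hm tm] := sphere_max_limits dNu Nl0 Pm_max.
(* Passing to [- u] flips the horizontal limit and leaves the vertical one unchanged, thanks to the
   absolute value. *)
move: hM tM hm tm; rewrite !horizN !enormN scalerN horiz_grad0.
by rewrite (_ : tc (- grad0 u) = - tc (grad0 u))// normrN.
Qed.
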